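(* Let $(X,\Phi)$ be a harmonic net whose edge weights are non-negative integers, and let $v$ be a vertex of $X$ such that the maximal eigenvalue of the local tension tensor $\mathcal{T}(v)$ equals $K_{\deg(v)}>0$. Let $X'$ be a periodic graph obtained from $X$ by splitting $v$ into $v_0$ and $v_1$ according to an eigenvector associated with this maximal eigenvalue, and let $e'$ be the new non-loop edge of $X'$, joining $v_0$ and $v_1$ (whose weight is possibly zero). Let $\Phi'$ be a harmonic realization of $X'$ with the same period homomorphism as $\Phi$. Then \[ \|\Phi'(e')\|=\|\Phi'(v_1)-\Phi'(v_0)\|\ \ge\ \frac{\sqrt{2K_{\deg(v)}}}{\deg(v)} . \]
   Context: A weighted graph $X=(V,E,w)$ has a vertex set $V$, a set $E$ of oriented edges, maps $o,t\colon E\to V$ and $\iota\colon E\to E$ with $\iota^2=\mathrm{id}$, $\iota(e)\ne e$, $o(\iota(e))=t(e)$, and a weight function $w\colon E\to\mathbb{R}_{\ge0}$ with $w\circ\iota=w$. Loops and multiple edges are allowed; parallel edges may be merged by adding their weights. The degree is $\deg(v)=\sum_{o(e)=v}w(e)$ (a loop contributes twice its weight). $X$ is connected if the 1-complex formed by all vertices and the positive-weight edges is connected. A periodic graph is an infinite connected weighted graph with an action of $L=\mathbb{Z}^N$ ($N\ge1$) by weight-preserving automorphisms such that $X\to X/L$ is a covering and $X/L=(V/L,E/L)$ is finite. A periodic realization of $X$ is a map $\Phi\colon V\to\mathbb{R}^N$ together with an injective homomorphism $\rho\colon L\to\mathbb{R}^N$ (the period homomorphism) whose image is a lattice, with $\Phi(\gamma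 v)=\Phi(v)+\rho(\gamma)$. A net is a pair $(X,\Phi)$ of a periodic graph and a periodic realization. For an edge $e$, $\Phi(e):=\Phi(t(e))-\Phi(o(e))$. The energy is $\mathcal{E}(X,\Phi)=\frac12\sum_{e\in E/L}w(e)\|\Phi(e)\|^2$. $\Phi$ is harmonic (and $(X,\Phi)$ a harmonic net) if it minimizes $\mathcal{E}$ among periodic realizations with the same $\rho$; equivalently $\sum_{o(e)=v}w(e)\Phi(e)=0$ for all $v\in V$. The local tension tensor at $v$ is the symmetric matrix $\mathcal{T}(v)=\sum_{o(e)=v}w(e)\Phi(e)\Phi(e)^{\mathsf T}$. Constants $K_d>0$ ($d>0$) are fixed. Splitting of $v$: let $\bm{u}$ be an eigenvector of $\mathcal{T}(v)$ for its maximal eigenvalue. The non-loop edges originating from $v$ are divided into two classes, class $0$ and class $1$, so that $\bm{u}\cdot\Phi(e)\le0$ for $e$ in class $0$ and $\bm{u}\cdot\Phi(e)\ge0$ for $e$ in class $1$. The vertex $v$ is replaced by two vertices $v_0,v_1$, and each edge of class $i$ now originates from $v_i$. The loop on $v$, of total weight $w_{\mathrm{loop}}\ge0$, is replaced by a loop on $v_0$, a loop on $v_1$ and a non-loop edge $e'$ between $v_0$ and $v_1$, with weights $p_0w_{\mathrm{loop}}$, $p_1w_{\mathrm{loop}}$, $p_{01}w_{\mathrm{loop}}$, where $p_0,p_1,p_{01}\ge0$ are fixed with $p_0+p_1+p_{01}=1$. All this is done $L$-equivariantly (simultaneously at all $\gamma v$, $\gamma\in L$; an edge from $v$ to $\gamma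 v$ has each of its two ends reassigned according to the class of the corresponding orientation), and the rest of the graph is unchanged; the result is a periodic graph $X'$ with period $L$. *)

(* Defs.v *)
From HB Require Import structures.
From mathcomp Require Import all_boot all_order all_algebra generic_quotient.
From mathcomp Require Import all_classical all_reals.
From Stdlib Require Import Relation_Operators.
Set Implicit Arguments.
Unset Strict Implicit.
Unset Printing Implicit Defensive.
Import Order.TTheory GRing.Theory Num.Theory.
Local Open Scope classical_set_scope.
Local Open Scope quotient_scope.
Local Open Scope ring_scope.

(* R^N is ['rV[R]_N]. The Euclidean norm is defined here because the norm that
   MathComp-Analysis puts on matrices is the sup norm. *)
Definition dot (R : realType) (N : nat) (x y : 'rV[R]_N) : R :=
  \sum_(i < N) x 0 i * y 0 i.

Definition enorm (R : realType) (N : nat) (x : 'rV[R]_N) : R :=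
  Num.sqrt (dot x x).

(* The integer span of a basis (the rows of [B]) of R^N. *)
Definition lattice (R : realType) (N : nat) (A : set 'rV[R]_N) : Prop :=
  exists2 B : 'M[R]_N, B \in unitmx &
    A = range (fun z : 'rV[int]_N => map_mx intr z *m B).

(* As in [eigenvalue], matrices act on row vectors from the right; this is
   immaterial below, where the matrices are symmetric. *)
Definition eigenvector (R : realType) (N : nat) (A : 'M[R]_N) (a : R)
    (u : 'rV[R]_N) : Prop :=
  u != 0 /\ u *m A = a *: u.

Definition max_eigenvalue (R : realType) (N : nat) (A : 'M[R]_N) (a : R) :
    Prop :=
  eigenvalue A a /\ forall b, eigenvalue A b -> b <= a.

Record Zaction (N : nat) (T : choiceType) := {
  act :> 'rV[int]_N -> T -> T;
  act0 : forall x, act 0 x = x;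
  actD : forall g h x, act (g + h) x = act g (act h x)
}.

Definition Zorbit (N : nat) (T : choiceType) (a : Zaction N T) (x : T) :
    set T := [set y | exists g, y = a g x].

Definition orbit_rel (N : nat) (T : choiceType) (a : Zaction N T) : rel T :=
  fun x y => `[< Zorbit a x y >].

Lemma actNK (N : nat) (T : choiceType) (a : Zaction N T) g x :
  a (- g) (a g x) = x.
Proof. by rewrite -actD addNr act0. Qed.

Lemma orbit_rel_equiv (N : nat) (T : choiceType) (a : Zaction N T) :
  equiv_class_of (orbit_rel a).
Proof.
have sym x y : orbit_rel a x y -> orbit_rel a y x.
  move=> /asboolP[g ->]; apply/asboolP; exists (- g).
  by rewrite actNK.
split.
- by move=> x; apply/asboolP; exists 0; rewrite act0.
- by move=> x y; apply/idP/idP; apply: sym.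
- move=> y x z /asboolP[g ->] /asboolP[h ->]; apply/asboolP.
  by exists (h + g); rewrite actD.
Qed.

Canonical orbit_equiv (N : nat) (T : choiceType) (a : Zaction N T) :=
  EquivRelPack (orbit_rel_equiv a).

Definition quotient (N : nat) (T : choiceType) (a : Zaction N T) :=
  {eq_quot (orbit_equiv a)}.

Record wgraph (R : realType) := {
  vert : choiceType;
  edge : choiceType;
  org : edge -> vert;
  tgt : edge -> vert;
  rev_edge : edge -> edge;
  wt : edge -> R;
  invK : forall e, rev_edge (rev_edge e) = e;
  inv_neq : forall e, rev_edge e <> e;
  org_inv : forall e, org (rev_edge e) = tgt e;
  wt_ge0 : forall e, 0 <= wt e;
  wt_inv : forall e, wt (rev_edge e) = wt e
}.

Record Lgraph (R : realType) (N : nat) := {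
  graph :> wgraph R;
  actV : Zaction N (vert graph);
  actE : Zaction N (edge graph);
  org_act : forall g e, org (actE g e) = actV g (org e);
  tgt_act : forall g e, tgt (actE g e) = actV g (tgt e);
  inv_act : forall g e, rev_edge (actE g e) = actE g (rev_edge e);
  wt_act : forall g e, wt (actE g e) = wt e
}.

Definition star (R : realType) (X : wgraph R) (v : vert X) : set (edge X) :=
  [set e | org e = v].

(* [\sum_(_ \in _)] is the sum over a set of finite support; in a periodic
   graph, stars are finite. *)
Definition deg (R : realType) (X : wgraph R) (v : vert X) : R :=
  \sum_(e \in star v) wt e.

Definition connected_graph (R : realType) (X : wgraph R) : Prop :=
  forall x y : vert X,
    clos_refl_trans (vert X)
      (fun a b => exists e : edge X, [/\ 0 < wt e, org e = a & tgt e = b]) x y.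

Definition Vquot (R : realType) (N : nat) (X : Lgraph R N) :=
  quotient (actV X).
Definition Equot (R : realType) (N : nat) (X : Lgraph R N) :=
  quotient (actE X).

(* The origin map of X/L; by [org_act] it does not depend on the choice of
   the representative [repr q]. *)
Definition qorg (R : realType) (N : nat) (X : Lgraph R N) (q : Equot X) :
    Vquot X := \pi_(Vquot X) (org (repr q)).

(* The first clause says that the edge reversal induced on X/L has no fixed
   point, so that X/L is a graph; the second one that the projection maps each
   star bijectively onto a star of X/L. *)
Definition quotient_covering (R : realType) (N : nat) (X : Lgraph R N) :
    Prop :=
  (forall e : edge X, \pi_(Equot X) (rev_edge e) <> \pi_(Equot X) e) /\
  (forall v : vert X,
     set_bij (star v) [set q : Equot X | qorg q = \pi_(Vquot X) v]
             (fun e => \pi_(Equot X) e)).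

Definition periodic (R : realType) (N : nat) (X : Lgraph R N) : Prop :=
  [/\ infinite_set [set: vert X],
      connected_graph X,
      quotient_covering X,
      finite_set [set: Vquot X] &
      finite_set [set: Equot X]].

Definition realization (R : realType) (N : nat) (X : Lgraph R N)
    (rho : {additive 'rV[int]_N -> 'rV[R]_N}) (Phi : vert X -> 'rV[R]_N) :
    Prop :=
  [/\ injective rho,
      lattice (range rho) &
      forall g x, Phi (actV X g x) = Phi x + rho g].

Definition edge_vec (R : realType) (N : nat) (X : wgraph R)
    (Phi : vert X -> 'rV[R]_N) (e : edge X) : 'rV[R]_N :=
  Phi (tgt e) - Phi (org e).

(* For a periodic realization the summand is L-invariant, so it does not
   depend on the choice of [repr q]. *)
Definition energy (R : realType) (N : nat) (X : Lgraph R N)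
    (Phi : vert X -> 'rV[R]_N) : R :=
  2^-1 * \sum_(q \in [set: Equot X])
           wt (repr q) * enorm (edge_vec Phi (repr q)) ^+ 2.

Definition harmonic (R : realType) (N : nat) (X : Lgraph R N)
    (rho : {additive 'rV[int]_N -> 'rV[R]_N}) (Phi : vert X -> 'rV[R]_N) :
    Prop :=
  realization rho Phi /\
  forall Psi : vert X -> 'rV[R]_N,
    realization rho Psi -> energy Phi <= energy Psi.

(* For a row vector [x], [x^T *m x] is the N x N matrix (x_i x_j). *)
Definition tension (R : realType) (N : nat) (X : wgraph R)
    (Phi : vert X -> 'rV[R]_N) (v : vert X) : 'M[R]_N :=
  \sum_(e \in star v) wt e *: ((edge_vec Phi e)^T *m edge_vec Phi e).

(* [cls e = true] means that [e] is in class 1. Only its values on the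
   non-loop edges issuing from the orbit of [v] matter; by [clsL] they are
   determined by those on the star of [v]. *)
Record split_data (R : realType) (N : nat) (X : Lgraph R N) := {
  cls : edge X -> bool;
  clsL : forall g e, cls (actE X g e) = cls e;
  p0 : R;
  p1 : R;
  p01 : R;
  p0_ge0 : 0 <= p0;
  p1_ge0 : 0 <= p1;
  p01_ge0 : 0 <= p01;
  p_sum : p0 + p1 + p01 = 1
}.

Definition split_along (R : realType) (N : nat) (X : Lgraph R N)
    (Phi : vert X -> 'rV[R]_N) (v : vert X) (u : 'rV[R]_N)
    (s : split_data X) : Prop :=
  forall e : edge X, org e = v -> tgt e <> v ->
    if cls s e then 0 <= dot u (edge_vec Phi e)
    else dot u (edge_vec Phi e) <= 0.

Section Split.
Variables (R : realType) (N : nat) (X : Lgraph R N) (v : vert X).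
Variable s : split_data X.

Let inLv (x : vert X) : bool := x \in Zorbit (actV X) v.

Lemma inLv_act g x : inLv (actV X g x) = inLv x.
Proof.
apply/idP/idP; rewrite /inLv !in_setE => -[h Eh].
  by exists (- g + h); rewrite actD -Eh actNK.
by exists (g + h); rewrite actD -Eh.
Qed.

(* A vertex [x] in the orbit of [v] gives rise to [(x, false)] and
   [(x, true)], any other vertex to [(x, false)] only. *)
Definition split_vert : choiceType :=
  {p : vert X * bool | p.2 ==> inLv p.1}.

Lemma lift_subproof (x : vert X) (b : bool) :
  (x, b && inLv x).2 ==> inLv (x, b && inLv x).1.
Proof. by case: b => //=; exact: implybb. Qed.

(* [x_b] if [x] is in the orbit of [v], and [x] otherwise. *)
Definition vlift (x : vert X) (b : bool) : split_vert :=
  exist _ (x, b && inLv x) (lift_subproof x b).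

(* The loops at the vertices of the orbit of [v] are removed. At each vertex
   [x] of this orbit, three pairs of opposite edges [(x, k, b)] are added:
   a loop at [x_i] for [k = Some i], and the edge from [x_b] to [x_(~~ b)] for
   [k = None]. *)
Definition old_edge : choiceType :=
  {e : edge X | ~~ ((org e == tgt e) && inLv (org e))}.
Definition new_edge : choiceType :=
  ({x : vert X | inLv x} * option bool * bool)%type.
Definition split_edge : choiceType := (old_edge + new_edge)%type.

Lemma old_inv_subproof (e : old_edge) :
  ~~ ((org (rev_edge (val e)) == tgt (rev_edge (val e))) && inLv (org (rev_edge (val e)))).
Proof.
have := valP e; rewrite org_inv -(org_inv (rev_edge (val e))) invK eq_sym.
by case: eqP => //= <-.
Qed.

Definition split_inv (e : split_edge) : split_edge :=
  match e with
  | inl a => inl (exist _ (rev_edge (val a)) (old_inv_subproof a))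
  | inr (x, k, b) => inr (x, k, ~~ b)
  end.

Definition split_org (e : split_edge) : split_vert :=
  match e with
  | inl a => vlift (org (val a)) (cls s (val a))
  | inr (x, Some i, _) => vlift (val x) i
  | inr (x, None, b) => vlift (val x) b
  end.

Definition split_tgt (e : split_edge) : split_vert := split_org (split_inv e).

(* Each loop consists of two oriented edges. *)
Definition wloop : R :=
  2^-1 * \sum_(e \in [set e : edge X | org e = v /\ tgt e = v]) wt e.

Definition split_wt (e : split_edge) : R :=
  match e with
  | inl a => wt (val a)
  | inr (_, Some false, _) => p0 s * wloop
  | inr (_, Some true, _) => p1 s * wloop
  | inr (_, None, _) => p01 s * wloop
  end.

Lemma split_invK e : split_inv (split_inv e) = e.
Proof.
case: e => [a|[[x k] b]] /=; last by rewrite negbK.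
by congr inl; apply: val_inj; rewrite /= invK.
Qed.

Lemma split_inv_neq e : split_inv e <> e.
Proof.
case: e => [a|[[x k] b]] /=; last by case: b => -[].
by move=> [] /(congr1 val) /=; exact: inv_neq.
Qed.

Lemma wloop_ge0 : 0 <= wloop.
Proof.
rewrite mulr_ge0 ?invr_ge0 //.
by elim/big_ind: _ => // [x y|e _]; [exact: addr_ge0|exact: wt_ge0].
Qed.

Lemma split_wt_ge0 e : 0 <= split_wt e.
Proof.
have W := wloop_ge0.
case: e => [a|[[x [[]|]] b]] /=; first exact: wt_ge0.
- by rewrite mulr_ge0 ?p1_ge0.
- by rewrite mulr_ge0 ?p0_ge0.
- by rewrite mulr_ge0 ?p01_ge0.
Qed.

Lemma split_wt_inv e : split_wt (split_inv e) = split_wt e.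
Proof. by case: e => [a|[[x k] b]] //=; exact: wt_inv. Qed.

Definition split_wgraph : wgraph R :=
  {| vert := split_vert;
     edge := split_edge;
     org := split_org;
     tgt := split_tgt;
     rev_edge := split_inv;
     wt := split_wt;
     invK := split_invK;
     inv_neq := split_inv_neq;
     org_inv := fun _ => erefl;
     wt_ge0 := split_wt_ge0;
     wt_inv := split_wt_inv |}.

Definition split_actV_fun (g : 'rV[int]_N) (x : split_vert) : split_vert :=
  vlift (actV X g (val x).1) (val x).2.

Lemma split_actV0 x : split_actV_fun 0 x = x.
Proof.
apply: val_inj; rewrite /= act0.
by case: x => [[x []]] //= ->.
Qed.

Lemma split_actVD g h x :
  split_actV_fun (g + h) x = split_actV_fun g (split_actV_fun h x).
Proof. by apply: val_inj; rewrite /= actD !inLv_act -andbA andbb. Qed.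

Definition split_actV : Zaction N split_vert :=
  {| act := split_actV_fun; act0 := split_actV0; actD := split_actVD |}.

Lemma old_act_subproof g (e : old_edge) :
  ~~ ((org (actE X g (val e)) == tgt (actE X g (val e)))
      && inLv (org (actE X g (val e)))).
Proof.
have := valP e; rewrite org_act tgt_act inLv_act; apply: contra.
move=> /andP[/eqP E ->]; rewrite andbT.
by rewrite -(actNK (actV X) g (org _)) E actNK.
Qed.

Lemma new_act_subproof g (x : {x : vert X | inLv x}) :
  inLv (actV X g (val x)).
Proof. by rewrite inLv_act; exact: valP. Qed.

Definition split_actE_fun (g : 'rV[int]_N) (e : split_edge) : split_edge :=
  match e with
  | inl a => inl (exist _ (actE X g (val a)) (old_act_subproof g a))
  | inr (x, k, b) =>
      inr (exist _ (actV X g (val x)) (new_act_subproof g x), k, b)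
  end.

Lemma split_actE0 e : split_actE_fun 0 e = e.
Proof.
case: e => [a|[[x k] b]] /=.
  by congr inl; apply: val_inj; rewrite /= act0.
by congr (inr (_, _, _)); apply: val_inj; rewrite /= act0.
Qed.

Lemma split_actED g h e :
  split_actE_fun (g + h) e = split_actE_fun g (split_actE_fun h e).
Proof.
case: e => [a|[[x k] b]] /=.
  by congr inl; apply: val_inj; rewrite /= actD.
by congr (inr (_, _, _)); apply: val_inj; rewrite /= actD.
Qed.

Definition split_actE : Zaction N split_edge :=
  {| act := split_actE_fun; act0 := split_actE0; actD := split_actED |}.

Lemma split_inv_act g e :
  split_inv (split_actE g e) = split_actE g (split_inv e).
Proof.
case: e => [a|[[x k] b]] //=.
by congr inl; apply: val_inj; rewrite /= inv_act.
Qed.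

Lemma split_org_act g e :
  split_org (split_actE g e) = split_actV g (split_org e).
Proof.
apply: val_inj; case: e => [a|[[x [i|]] b]] /=.
- by rewrite org_act clsL inLv_act -andbA andbb.
- by rewrite inLv_act -andbA andbb.
- by rewrite inLv_act -andbA andbb.
Qed.

Lemma split_tgt_act g e :
  split_tgt (split_actE g e) = split_actV g (split_tgt e).
Proof. by rewrite /split_tgt split_inv_act split_org_act. Qed.

Lemma split_wt_act g e : split_wt (split_actE g e) = split_wt e.
Proof. by case: e => [a|[[x k] b]] //=; exact: wt_act. Qed.

Definition split_graph : Lgraph R N :=
  {| graph := split_wgraph;
     actV := split_actV;
     actE := split_actE;
     org_act := split_org_act;
     tgt_act := split_tgt_act;
     inv_act := split_inv_act;
     wt_act := split_wt_act |}.

Definition split_v0 : vert split_graph := vlift v false.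
Definition split_v1 : vert split_graph := vlift v true.

Lemma inLv_self : inLv v.
Proof. by rewrite /inLv in_setE; exists 0; rewrite act0. Qed.

(* The edge e', oriented from [split_v0] to [split_v1]. *)
Definition split_e : edge split_graph := inr (exist _ v inLv_self, None, false).

End Split.

(* Main.v *)
Require Import Defs.
From HB Require Import structures.
From mathcomp Require Import all_boot all_order all_algebra.
From mathcomp Require Import all_classical all_reals.
From mathcomp Require Import generic_quotient ring lra.
Set Implicit Arguments.
Unset Strict Implicit.
Import Order.TTheory GRing.Theory Num.Theory.
Local Open Scope ring_scope.
Local Open Scope classical_set_scope.
Local Open Scope quotient_scope.

(* Let [Psi] be the realization of X' obtained from [Phi] by keeping [v_0] and [v_1]
   at the position of [v]. By harmonicity of [Phi], the variation of the energy at
   [Psi] in the direction of an invariant map [k] is [- f . (k v_1 - k v_0)], where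
   [f] is the total force of the class 1 edges at [v]; hence, for [h = Phi' - Psi]
   and the Dirichlet form [B], [B h k = 2 f . (k v_1 - k v_0)]. Take [k] equal to
   [f / 2] on the orbit of [v_1], to [- f / 2] on that of [v_0], and to 0 elsewhere.
   Then [B k k <= deg v |f|^2], because the degrees of [v_0] and [v_1] add up to
   [deg v], and positivity of [B] at [h - (2 / deg v) k] yields
   [f . (Phi' v_1 - Phi' v_0) >= (2 / deg v) |f|^2], so that
   [|Phi' v_1 - Phi' v_0| >= 2 |f| / deg v]. Finally, writing [a_e = u . Phi e],
   balance at [v] makes the sums of [w_e |a_e|] over the two classes both equal to
   [u . f], and integrality of the weights gives
   [K |u|^2 = \sum_e w_e a_e^2 <= 2 (u . f)^2 <= 2 |u|^2 |f|^2]. *)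

(** * Euclidean inner product and Cauchy-Schwarz *)

Section Dot.
Variables (R : realType) (N : nat).
Implicit Types (x y z : 'rV[R]_N) (a : R).

Lemma dotC x y : dot x y = dot y x.
Proof. by apply: eq_bigr => i _; rewrite mulrC. Qed.

Lemma dotDr x y z : dot x (y + z) = dot x y + dot x z.
Proof. by rewrite -big_split; apply: eq_bigr => i _; rewrite mxE mulrDr. Qed.

Lemma dotZr a x y : dot x (a *: y) = a * dot x y.
Proof. by rewrite mulr_sumr; apply: eq_bigr => i _; rewrite mxE mulrCA. Qed.

Lemma dotNr x y : dot x (- y) = - dot x y.
Proof. by rewrite -scaleN1r dotZr mulN1r. Qed.

Lemma dotBr x y z : dot x (y - z) = dot x y - dot x z.
Proof. by rewrite dotDr dotNr. Qed.

Lemma dot0r x : dot x 0 = 0.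
Proof. by rewrite -(scale0r x) dotZr mul0r. Qed.

Lemma dotDl x y z : dot (x + y) z = dot x z + dot y z.
Proof. by rewrite ![dot _ z]dotC dotDr. Qed.

Lemma dotZl a x y : dot (a *: x) y = a * dot x y.
Proof. by rewrite ![dot _ y]dotC dotZr. Qed.

Lemma dotNl x y : dot (- x) y = - dot x y.
Proof. by rewrite ![dot _ y]dotC dotNr. Qed.

Lemma dotBl x y z : dot (x - y) z = dot x z - dot y z.
Proof. by rewrite dotDl dotNl. Qed.

Lemma dot0l x : dot 0 x = 0.
Proof. by rewrite dotC dot0r. Qed.

Lemma dot_ge0 x : 0 <= dot x x.
Proof. by apply: sumr_ge0 => i _; rewrite -expr2 sqr_ge0. Qed.

Lemma dot_gt0 x : (0 < dot x x) = (x != 0).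
Proof.
rewrite lt0r dot_ge0 andbT; congr negb; apply/eqP/eqP => [|->]; last exact: dot0l.
move=> /psumr_eq0P x0; apply/rowP => i; rewrite mxE; apply/eqP.
by rewrite -sqrf_eq0 expr2 x0 // => j _; rewrite -expr2 sqr_ge0.
Qed.

Lemma dot_fsumr (T : choiceType) (A : set T) (F : T -> 'rV[R]_N) x :
  finite_set A -> dot x (\sum_(i \in A) F i) = \sum_(i \in A) dot x (F i).
Proof.
move=> finA; rewrite !fsbig_finite //.
by elim/big_rec2: _ => [|i y1 y2 _ <-]; rewrite ?dot0r ?dotDr.
Qed.

Lemma enorm_sqr x : enorm x ^+ 2 = dot x x.
Proof. by rewrite sqr_sqrtr ?dot_ge0. Qed.

(** Cauchy-Schwarz: after multiplication by [|y|^2], the gap is the squared norm of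
    [|y|^2 x - (x . y) y]. *)
Lemma dot_sqr_le x y : dot x y ^+ 2 <= dot x x * dot y y.
Proof.
have [->|y0] := eqVneq y 0; first by rewrite !dot0r expr0n mulr0.
have yy : 0 < dot y y by rewrite dot_gt0.
rewrite -(ler_pM2l yy) -subr_ge0.
suff -> : dot y y * (dot x x * dot y y) - dot y y * dot x y ^+ 2 =
    dot (dot y y *: x - dot x y *: y) (dot y y *: x - dot x y *: y).
  exact: dot_ge0.
by rewrite !(dotBl, dotBr, dotZl, dotZr) (dotC y x); ring.
Qed.

Lemma dot_le_enorm x y : dot x y <= enorm x * enorm y.
Proof.
have [xy0|/ltW xy0] := leP (dot x y) 0.
  by rewrite (le_trans xy0) // mulr_ge0 ?sqrtr_ge0.
rewrite -(ler_pXn2r (n := 2)) ?nnegrE ?mulr_ge0 ?sqrtr_ge0 //.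
by rewrite exprMn !enorm_sqr dot_sqr_le.
Qed.

Lemma dot_sqr_sub_le x y : dot (x - y) (x - y) <= 2 * (dot x x + dot y y).
Proof.
have := dot_ge0 (x + y).
by rewrite !(dotBl, dotBr, dotDl, dotDr) (dotC y x); lra.
Qed.

End Dot.

(** * Sums of invariant functions over edge orbits *)

Section QuotientSum.
Variables (R : realType) (N : nat) (X : Lgraph R N).
Hypothesis finE : finite_set [set: Equot X].

Definition act_invariant (V : Type) (g : edge X -> V) :=
  forall a e, g (actE X a e) = g e.

Definition qsum (g : edge X -> R) : R :=
  \sum_(q \in [set: Equot X]) g (repr q).

Lemma repr_act e : exists a, repr (\pi_(Equot X) e) = actE X a e.
Proof.
have /eqmodP : \pi_(Equot X) e = \pi_(Equot X) (repr (\pi_(Equot X) e)).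
  by rewrite reprK.
by move=> /asboolP[a ->]; exists a.
Qed.

Lemma pi_act a e : \pi_(Equot X) (actE X a e) = \pi_(Equot X) e.
Proof. by apply/esym/eqmodP/asboolP; exists a. Qed.

Lemma invariant_repr V (g : edge X -> V) e :
  act_invariant g -> g (repr (\pi_(Equot X) e)) = g e.
Proof. by move=> gL; have [a ->] := repr_act e; rewrite gL. Qed.

Lemma qsumD g h : qsum (fun e => g e + h e) = qsum g + qsum h.
Proof. by rewrite /qsum fsbig_split. Qed.

Lemma qsumZ a g : qsum (fun e => a * g e) = a * qsum g.
Proof. by rewrite /qsum mulr_fsumr. Qed.

Lemma qsumB g h : qsum (fun e => g e - h e) = qsum g - qsum h.
Proof.
rewrite -[- qsum h]mulN1r -qsumZ -qsumD.
by apply: eq_fsbigr => q _; rewrite mulN1r.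
Qed.

Lemma qsum_ge0 g : (forall e, 0 <= g e) -> 0 <= qsum g.
Proof. by move=> g0; apply: fsumr_ge0. Qed.

Lemma ler_qsum g h : (forall e, g e <= h e) -> qsum g <= qsum h.
Proof.
by move=> gh; rewrite -subr_ge0 -qsumB qsum_ge0 // => e; rewrite subr_ge0.
Qed.

Lemma eq_qsum g h : g =1 h -> qsum g = qsum h.
Proof. by move=> gh; congr qsum; apply/funext. Qed.

(** A transversal may replace the canonical representatives: by invariance [g] depends only on the
    orbit, and orbits outside [B] contribute nothing. *)
Lemma qsum_transversal (A : set (edge X)) (B : set (Equot X)) (g : edge X -> R) :
  act_invariant g -> set_bij A B (fun e => \pi_(Equot X) e) ->
  (forall e, ~ B (\pi_(Equot X) e) -> g e = 0) ->
  qsum g = \sum_(e \in A) g e.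
Proof.
move=> gL AB g0; rewrite /qsum -(@fsbig_widen _ _ _ _ B) //.
  rewrite (reindex_fsbig _ _ _ _ AB); apply: eq_fsbigr => e _.
  exact: invariant_repr.
by move=> q [_ Bq] /=; apply: g0; rewrite reprK.
Qed.

Lemma qsum_rev g : act_invariant g -> qsum (fun e => g (rev_edge e)) = qsum g.
Proof.
move=> gL; pose r (q : Equot X) : Equot X := \pi_(Equot X) (rev_edge (repr q)).
have rK : involutive r.
  move=> q; rewrite /r -{2}[q]reprK.
  have [a ->] := repr_act (rev_edge (repr q)).
  by rewrite inv_act Defs.invK pi_act.
rewrite {2}/qsum (reindex_fsbigT _ _ (inv_bij rK)).
apply: eq_fsbigr => q _ /=; exact/esym/invariant_repr.
Qed.

End QuotientSum.

(** * Stars under the covering X -> X/L *)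

Section Star.
Variables (R : realType) (N : nat) (X : Lgraph R N).
Hypothesis finE : finite_set [set: Equot X].
Hypothesis cover : quotient_covering X.

Lemma finite_star (v : vert X) : finite_set (star v).
Proof.
have [_ /(_ v) [_ inj _]] := cover.
by rewrite -(eq_finite_set (inj_card_eq inj)); exact: sub_finite_set finE.
Qed.

(** The covering condition makes [star v] a transversal of the edge orbits issuing from the orbit of
    [v]. *)
Lemma qsum_star (v : vert X) (g : edge X -> R) :
  act_invariant g -> (forall e, ~ Zorbit (actV X) v (org e) -> g e = 0) ->
  qsum g = \sum_(e \in star v) g e.
Proof.
move=> gL g0; apply: (@qsum_transversal _ _ _ _ _ _ gL (cover.2 v)) => e.
move=> /= qe; apply: g0 => -[a ve]; apply: qe; rewrite /qorg.
have [b ->] := repr_act e.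
rewrite org_act ve -actD; apply/esym/eqmodP/asboolP; by exists (b + a).
Qed.
End Star.

(** * Dirichlet form and first variation of the energy *)

Section DirichletForm.
Variables (R : realType) (N : nat) (X : Lgraph R N).
Hypothesis finE : finite_set [set: Equot X].
Implicit Types F G h : vert X -> 'rV[R]_N.

(** This polarizes twice the energy. Realizations and invariant maps can both be arguments, since
    only edge vectors enter. *)
Definition dirichlet F G : R :=
  qsum (fun e : edge X => wt e * dot (edge_vec F e) (edge_vec G e)).

Lemma edge_vec_act F (c : 'rV[int]_N -> 'rV[R]_N) :
  (forall a x, F (actV X a x) = F x + c a) ->
  act_invariant (fun e : edge X => edge_vec F e).
Proof.
by move=> Fc a e; rewrite /edge_vec tgt_act org_act !Fc opprD addrACA subrr addr0.
Qed.

Lemma energyE F : energy F = 2^-1 * dirichlet F F.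
Proof. by congr (_ * _); apply: eq_fsbigr => q _; rewrite enorm_sqr. Qed.

Lemma dirichlet_ge0 F : 0 <= dirichlet F F.
Proof. by apply: qsum_ge0 => e; rewrite mulr_ge0 ?wt_ge0 ?dot_ge0. Qed.

Lemma dirichletC F G : dirichlet F G = dirichlet G F.
Proof. by apply: eq_qsum => e; rewrite dotC. Qed.

Lemma dirichletDZr F G h t :
  dirichlet F (fun x => G x + t *: h x) = dirichlet F G + t * dirichlet F h.
Proof.
rewrite /dirichlet -qsumZ -qsumD //; apply: eq_qsum => e.
have -> : edge_vec (fun x => G x + t *: h x) e = edge_vec G e + t *: edge_vec h e.
  by rewrite /edge_vec scalerBr opprD addrACA.
by rewrite dotDr dotZr; ring.
Qed.

Lemma dirichletDZ F h t :
  dirichlet (fun x => F x + t *: h x) (fun x => F x + t *: h x) =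
    dirichlet F F + 2 * t * dirichlet F h + t ^+ 2 * dirichlet h h.
Proof.
rewrite dirichletDZr (dirichletC _ F) (dirichletC _ h) !dirichletDZr.
by rewrite (dirichletC h F); ring.
Qed.

(** Summation by parts: reversing an edge flips [edge_vec F], so the terms with [h] at the target
    and those with [- h] at the origin have the same sum. *)
Lemma dirichlet_org F h :
  act_invariant (fun e : edge X => edge_vec F e) ->
  (forall a x, h (actV X a x) = h x) ->
  dirichlet F h = - 2 * qsum (fun e => wt e * dot (edge_vec F e) (h (org e))).
Proof.
move=> FL hL; pose k e := wt e * dot (edge_vec F e) (h (org e)).
have kL : act_invariant k by move=> a e; rewrite /k wt_act FL org_act hL.
transitivity (qsum (fun e => (-1) * (k (rev_edge e) + k e))).
  apply: eq_qsum => e; rewrite /k wt_inv /edge_vec -(org_inv (rev_edge e)) Defs.invK.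
  by rewrite org_inv !(dotBl, dotBr); ring.
by rewrite qsumZ qsumD // qsum_rev // -/k; ring.
Qed.

(** First variation: [F + t h] has the same periods, so the energy is a quadratic in [t] minimal at
    0, and its linear coefficient vanishes. *)
Lemma harmonic_dirichlet0 (rho : {additive 'rV[int]_N -> 'rV[R]_N}) F h :
  harmonic rho F -> (forall a x, h (actV X a x) = h x) -> dirichlet F h = 0.
Proof.
move=> [[rhoI rhoL FL] Fmin] hL.
set b := dirichlet F h; have := dirichlet_ge0 h; set c := dirichlet h h => c0.
(* Dividing by [c + 1] instead of [c] covers [c = 0] and still lowers the energy unless [b = 0]. *)
have : energy F <= energy (fun x => F x + (- b / (c + 1)) *: h x).
  by apply: Fmin; split=> // a x; rewrite FL hL addrAC.
rewrite !energyE dirichletDZ -/b -/c => H.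
have d0 : 0 < c + 1 by lra.
have E : 2 * (- b / (c + 1)) * b + (- b / (c + 1)) ^+ 2 * c =
   - (b ^+ 2 * ((c + 2) / (c + 1) ^+ 2)).
  by field; rewrite gt_eqF.
have : b ^+ 2 * ((c + 2) / (c + 1) ^+ 2) <= 0 by lra.
rewrite pmulr_lle0; last by rewrite divr_gt0 ?exprn_gt0 //; lra.
by move=> b0; apply/eqP; rewrite -sqrf_eq0 eq_le b0 sqr_ge0.
Qed.

End DirichletForm.

(** * Edge orbits of the split graph *)

Section SplitSum.
Variables (R : realType) (N : nat) (X : Lgraph R N) (v : vert X).
Variable s : split_data X.
Let X' := split_graph v s.
Hypothesis finE : finite_set [set: Equot X].
Hypothesis finE' : finite_set [set: Equot X'].

Let new (p : option bool * bool) : edge X' :=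
  inr (exist _ v (inLv_self v), p.1, p.2).

(** Old edge orbits correspond to those of X other than the loops on the orbit of [v], where [g] is
    0. Every new edge is a translate of exactly one of the six at [v]. *)
Lemma qsum_split (G : edge X' -> R) (g : edge X -> R) :
  act_invariant G -> act_invariant g ->
  (forall a : old_edge v, G (inl a) = g (val a)) ->
  (forall e, org e = tgt e -> Zorbit (actV X) v (org e) -> g e = 0) ->
  qsum G = qsum g + \sum_(p : option bool * bool) G (new p).
Proof.
move=> GL gL Gg g0.
pose is_old (e : edge X') := if e is inl _ then true else false.
have oldL : act_invariant is_old by move=> a [?|[[? ?] ?]].
pose G1 e := if is_old e then G e else 0.
pose G2 e := if is_old e then 0 else G e.
have G1L : act_invariant G1 by move=> a e; rewrite /G1 oldL GL.
have G2L : act_invariant G2 by move=> a e; rewrite /G2 oldL GL.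
have -> : qsum G = qsum G1 + qsum G2.
  rewrite -qsumD //; apply: eq_qsum => e.
  by rewrite /G1 /G2; case: ifP; rewrite ?addr0 ?add0r.
suff [-> ->] : qsum G1 = qsum g /\ qsum G2 = \sum_p G (new p) by [].
split; last first.
  (* The label [(k, b)] is invariant under the action and the base vertex can be moved to [v], so
     [range new] is a transversal. *)
  rewrite (@qsum_transversal _ _ _ (range new) [set q | ~~ is_old (repr q)] G2) //.
  - rewrite fsbig_image; last first.
      by move=> [k b] [k' b'] _ _ /= [-> ->].
    by rewrite [RHS]bigfs ?index_enum_uniq //=;
      [apply: eq_fsbigl; apply/seteqP; split | move=> p _; rewrite mem_index_enum].
  - split.
    + by move=> _ [p _ <-] /=; rewrite (invariant_repr _ oldL).
    + move=> _ _ /set_mem[p _ <-] /set_mem[p' _ <-] /eqmodP/asboolP[a].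
      by case: p p' => [k b] [k' b'] [_ -> ->].
    + move=> q /= qnew; move: (reprK q) qnew.
      case: (repr q) => [//|[[[x xv] k] b] <- _].
      have [a xE] := set_mem xv.
      exists (new (k, b)); first by exists (k, b).
      apply/eqmodP/asboolP; exists a; congr (inr (_, _, _)).
      exact: val_inj.
  - move=> e /=; rewrite (invariant_repr _ oldL) /G2.
    by case: (is_old e) => // -[].
pose nonloop (e : edge X) := ~~ ((org e == tgt e) && (org e \in Zorbit (actV X) v)).
have nlL : act_invariant nonloop.
  move=> a e; rewrite /nonloop org_act tgt_act inLv_act.
  by rewrite (inj_eq (can_inj (actNK (actV X) a))).
(* Old edges that represent their own orbit in X: the images of [S] under [val] and [inl] are
   transversals in X and X' respectively. *)
pose S := [set a : old_edge v | repr (\pi_(Equot X) (val a)) = val a].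
rewrite (@qsum_transversal _ _ X (val @` S) [set q | nonloop (repr q)] g) //.
- rewrite (@qsum_transversal _ _ X' (inl @` S) [set q | is_old (repr q)] G1) //.
  + rewrite !fsbig_image; last 2 first.
    * by move=> a b _ _ /val_inj.
    * by move=> a b _ _ [].
    by apply: eq_fsbigr => a _; rewrite -Gg.
  + split.
    * by move=> _ [a _ <-] /=; rewrite (invariant_repr _ oldL).
    * move=> _ _ /set_mem[a Sa <-] /set_mem[b Sb <-] /eqmodP/asboolP[c [E]].
      by congr inl; apply: val_inj; rewrite -Sa -Sb /= E pi_act.
    * move=> q /= qold; move: (reprK q) qold.
      case: (repr q) => [a <- _|//].
      have nlr : nonloop (repr (\pi_(Equot X) (val a))).
        by rewrite (invariant_repr _ nlL); exact: valP.
      exists (inl (exist nonloop _ nlr)).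
        by exists (exist nonloop _ nlr) => //; rewrite /S /= reprK.
      have [c E] := repr_act (val a).
      apply/esym/eqmodP/asboolP; exists c; congr inl; apply: val_inj; exact: E.
  + move=> e /=; rewrite (invariant_repr _ oldL) /G1.
    by case: (is_old e) => // -[].
- split.
  + by move=> _ [a Sa <-] /=; rewrite (invariant_repr _ nlL); exact: valP.
  + by move=> _ _ /set_mem[a Sa <-] /set_mem[b Sb <-] /= E; rewrite -Sa -Sb E.
  + move=> q /= nlq; exists (repr q); last by rewrite reprK.
    by exists (exist nonloop (repr q) nlq) => //; rewrite /S /= reprK.
- move=> e /=; rewrite (invariant_repr _ nlL) => /negP; rewrite negbK.
  move=> /andP[/eqP E L].
  by apply: g0 => //; exact: set_mem.
Qed.

End SplitSum.

(** * Comparing the harmonic realizations of X and X' *)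

Section Collapse.
Variables (R : realType) (N : nat) (X : Lgraph R N) (v : vert X).
Variable s : split_data X.
Let X' := split_graph v s.
Hypothesis finE : finite_set [set: Equot X].
Hypothesis finE' : finite_set [set: Equot X'].
Hypothesis cover : quotient_covering X.
Variables (rho : {additive 'rV[int]_N -> 'rV[R]_N}) (Phi : vert X -> 'rV[R]_N).
Hypothesis harmPhi : harmonic rho Phi.

Lemma harmonic_edge_vec_act : act_invariant (fun e : edge X => edge_vec Phi e).
Proof. by have [[_ _ PhiL] _] := harmPhi; exact: edge_vec_act PhiL. Qed.

Lemma harmonic_balance : \sum_(e \in star v) wt e *: edge_vec Phi e = 0.
Proof.
set S := \sum_(e \in _) _.
(* The test map is the total force at [v], spread over its orbit; the first variation is then
   [- 2 |S|^2]. *)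
pose h x := if x \in Zorbit (actV X) v then S else 0.
have hL a x : h (actV X a x) = h x by rewrite /h inLv_act.
have := harmonic_dirichlet0 finE harmPhi hL.
rewrite dirichlet_org //; last exact: harmonic_edge_vec_act.
rewrite (qsum_star cover (v := v)) //; first last.
- move=> e ve; rewrite /h memNset // dot0r mulr0 //.
- by move=> a e; rewrite wt_act harmonic_edge_vec_act org_act hL.
rewrite (eq_fsbigr (fun e => dot S (wt e *: edge_vec Phi e))); last first.
  by move=> e /set_mem ev; rewrite ev /h inLv_self dotC dotZr.
rewrite -dot_fsumr; last exact: finite_star.
move=> /eqP; rewrite -/S mulf_eq0 oppr_eq0 pnatr_eq0 /= => S0.
by apply/eqP; rewrite -[_ == _]negbK -dot_gt0 (eqP S0) ltxx.
Qed.

(** The realization [Psi] of the opening overview. *)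
Definition collapse (y : vert X') : 'rV[R]_N := Phi (val y).1.

(** The vector [f] of the overview; loops contribute nothing, their edge vector being 0. *)
Definition class_force : 'rV[R]_N :=
  \sum_(e \in star v) (if cls s e then wt e else 0) *: edge_vec Phi e.

Lemma vlift_act a x b : vlift v (actV X a x) b = actV X' a (vlift v x b).
Proof. by apply: val_inj; rewrite /= inLv_act -andbA andbb. Qed.

Lemma collapse_realization : realization rho collapse.
Proof.
by have [[? ? PhiL] _] := harmPhi; split=> // a y; rewrite /collapse PhiL.
Qed.

(** New edges have zero vector under [collapse]. On old edges, [k] at the origin is its value at
    copy 0 plus, for class 1 edges issuing from the orbit of [v], the jump [D]; harmonicity of [Phi]
    removes the first part. *)
Lemma dirichlet_collapse (k : vert X' -> 'rV[R]_N) :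
  (forall a y, k (actV X' a y) = k y) ->
  dirichlet collapse k =
    - 2 * dot class_force (k (split_v1 v s) - k (split_v0 v s)).
Proof.
move=> kL; have [_ _ PsiL] := collapse_realization.
have PhiE := harmonic_edge_vec_act.
rewrite dirichlet_org //; last exact: edge_vec_act PsiL.
congr (_ * _).
pose g e := wt e * dot (edge_vec Phi e) (k (vlift v (org e) (cls s e))).
have gL : act_invariant g.
  by move=> a e; rewrite /g wt_act PhiE org_act clsL vlift_act kL.
rewrite (@qsum_split _ _ _ _ _ finE' _ g) //; first last.
- by move=> e oe _; rewrite /g /edge_vec oe subrr dot0l mulr0.
- by move=> a; rewrite /g /edge_vec /collapse /= org_inv.
- move=> a e; rewrite wt_act org_act kL.
  by rewrite (edge_vec_act PsiL).
rewrite big1 ?addr0 => [|[[i|] b] _]; last 2 first.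
- by rewrite /edge_vec /collapse /= subrr dot0l mulr0.
- by rewrite /edge_vec /collapse /= subrr dot0l mulr0.
pose kb x := k (vlift v x false).
have kbL a x : kb (actV X a x) = kb x by rewrite /kb vlift_act kL.
set D := k (split_v1 v s) - k (split_v0 v s).
pose inc e := if cls s e && (org e \in Zorbit (actV X) v) then D else 0.
have incL : act_invariant inc by move=> a e; rewrite /inc clsL org_act inLv_act.
have kE e : k (vlift v (org e) (cls s e)) = kb (org e) + inc e.
  rewrite /kb /inc; case: (cls s e) => /=; last by rewrite addr0.
  case: ifPn => [/set_mem[a ->]|nv].
    by rewrite !vlift_act !kL addrC subrK.
  by rewrite addr0; congr k; apply: val_inj; rewrite /= (negbTE nv).
have -> : qsum g = qsum (fun e => wt e * dot (edge_vec Phi e) (kb (org e))) +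
                   qsum (fun e => wt e * dot (edge_vec Phi e) (inc e)).
  by rewrite -qsumD //; apply: eq_qsum => e; rewrite /g kE dotDr mulrDr.
have := harmonic_dirichlet0 finE harmPhi kbL.
rewrite dirichlet_org // => /eqP; rewrite mulf_eq0 oppr_eq0 pnatr_eq0 /= => /eqP ->.
rewrite add0r (qsum_star cover (v := v)) //; first last.
- by move=> e ve; rewrite /inc memNset // andbF dot0r mulr0.
- by move=> a e; rewrite wt_act PhiE incL.
rewrite dotC dot_fsumr; last exact: finite_star.
apply: eq_fsbigr => e /set_mem ev; rewrite /inc ev inLv_self andbT dotZr.
by case: ifP => _; rewrite dotC ?dot0l ?mulr0 ?mul0r.
Qed.

(** Each of the three new edges occurs in both orientations, and the proportions add up to 1. *)
Lemma wt_new_edges :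
  \sum_(p : option bool * bool)
     split_wt s (inr (exist _ v (inLv_self v), p.1, p.2)) = 2 * wloop v.
Proof.
rewrite -(pair_bigA _ (fun k b => split_wt s (inr (exist _ v (inLv_self v), k, b)))) /=.
rewrite (bigD1 None) //= (bigD1 (Some true)) //= (bigD1 (Some false)) //=.
rewrite [X in _ + (_ + (_ + X))]big1; last by move=> [[]|].
transitivity ((p0 s + p1 s + p01 s) * (2 * wloop v)); last by rewrite p_sum mul1r.
by rewrite !big_bool /=; ring.
Qed.

(** By [|x - y|^2 <= 2 (|x|^2 + |y|^2)] and edge reversal, the form is at most
    [4 \sum_e w_e |k (org e)|^2], which is [4 c] times the total degree of [v_0] and [v_1]. *)
Lemma dirichlet_split_le (k : vert X' -> 'rV[R]_N) (c : R) :
  (forall a y, k (actV X' a y) = k y) ->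
  (forall y, dot (k y) (k y) =
     if (val y).1 \in Zorbit (actV X) v then c else 0) ->
  dirichlet k k <= 4 * c * deg v.
Proof.
move=> kL kc.
pose n (e : edge X') := wt e * dot (k (org e)) (k (org e)).
have nL : act_invariant n by move=> a e; rewrite /n wt_act org_act kL.
apply: (@le_trans _ _ (qsum (fun e => 2 * (n (rev_edge e) + n e)))).
  apply: ler_qsum => // e.
  rewrite /n wt_inv org_inv -mulrDr mulrCA ler_wpM2l ?wt_ge0 //.
  exact: dot_sqr_sub_le.
rewrite qsumZ qsumD // qsum_rev //.
suff -> : qsum n = c * deg v by rewrite le_eqVlt; apply/orP; left; apply/eqP; ring.
(* Loops at [v] are absent from the old edges; their weight [2 * wloop v] is recovered from the new
   ones. *)
pose g (e : edge X) :=
  if (org e \in Zorbit (actV X) v) && (org e != tgt e) then c * wt e else 0.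
have gL : act_invariant g.
  move=> a e; rewrite /g wt_act org_act tgt_act inLv_act.
  by rewrite (inj_eq (can_inj (actNK (actV X) a))).
rewrite (@qsum_split _ _ _ _ _ finE' _ g) //; first last.
- by move=> e oe _; rewrite /g oe eqxx andbF.
- move=> e; rewrite /n kc /g /= mulrC.
  have := valP e; case: (_ \in _) => /=; rewrite ?mul0r //.
  by rewrite andbT => ->.
have -> : \sum_(p : option bool * bool)
    n (inr (exist _ v (inLv_self v), p.1, p.2)) = c * (2 * wloop v).
  rewrite -wt_new_edges mulr_sumr; apply: eq_bigr => -[[i|] b] _;
  by rewrite /n kc /= inLv_self mulrC.
rewrite (qsum_star cover (v := v)) //; last first.
  by move=> e ve; rewrite /g memNset.
rewrite /wloop (mulrA 2 2^-1) divff ?mul1r ?pnatr_eq0 //.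
have -> : \sum_(e \in [set e : edge X | org e = v /\ tgt e = v]) wt e =
   \sum_(e \in star v) (if org e == tgt e then wt e else 0).
  have -> : [set e : edge X | org e = v /\ tgt e = v] =
      star v `&` [set e | org e == tgt e].
    apply/seteqP; split=> e [/= oe]; first by rewrite oe => ->.
    by move=> /eqP <-.
  by rewrite fsbig_mkcondr; apply: eq_fsbigr => e _; rewrite mem_setE.
rewrite mulr_fsumr -fsbig_split /=; last exact: finite_star.
rewrite /deg mulr_fsumr; apply: eq_fsbigr => e /set_mem ev.
rewrite /g ev inLv_self /=; case: eqP => _ /=; first by rewrite add0r.
by rewrite mulr0 addr0.
Qed.

Lemma class_force_le (Phi' : vert X' -> 'rV[R]_N) :
  harmonic rho Phi' -> 0 < deg v ->
  2 * dot class_force class_force <=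
    deg v * dot class_force (Phi' (split_v1 v s) - Phi' (split_v0 v s)).
Proof.
move=> harm' d0; set D := Phi' _ - Phi' _; set f := class_force.
have [_ _ PsiL] := collapse_realization.
have [[_ _ PhiL'] _] := harm'.
pose h y := Phi' y + (-1) *: collapse y.
pose k (y : vert X') := (if (val y).1 \in Zorbit (actV X) v then
  if (val y).2 then 2^-1 else - 2^-1 else 0) *: f.
have hL a y : h (actV X' a y) = h y.
  by rewrite /h PhiL' PsiL !scaleN1r opprD addrACA subrr addr0.
have kL a y : k (actV X' a y) = k y.
  rewrite /k /= !inLv_act; case: ifP => // yv.
  by rewrite yv andbT.
(* The [Phi'] part of [h] drops out by harmonicity, leaving minus the [collapse] part. *)
have hE j : (forall a y, j (actV X' a y) = j y) ->
    dirichlet j h = 2 * dot f (j (split_v1 v s) - j (split_v0 v s)).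
  move=> jL; rewrite dirichletDZr // dirichletC (harmonic_dirichlet0 finE' harm' jL).
  by rewrite dirichletC dirichlet_collapse // -/f; ring.
have kk : dirichlet k k <= dot f f * deg v.
  have -> : dot f f * deg v = 4 * (2^-1 ^+ 2 * dot f f) * deg v by field.
  apply: dirichlet_split_le => // y; rewrite /k dotZl dotZr mulrA.
  by case: ifP => _; [case: ifP => _; rewrite ?mulrNN | rewrite mul0r mul0r].
have kD : k (split_v1 v s) - k (split_v0 v s) = f.
  rewrite /k /= inLv_self /= -scalerBl.
  have -> : 2^-1 - - 2^-1 = 1 :> R by field.
  exact: scale1r.
have hD : h (split_v1 v s) - h (split_v0 v s) = D.
  by rewrite /h opprD addrACA -scalerBr subrr scaler0 addr0.
(* The value [t = 2 / deg v] minimizes [- 4 t |f|^2 + t^2 deg v |f|^2], which bounds the change of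
   the form from [h] to [h - t k]. *)
have := dirichlet_ge0 (fun y => h y + (- (2 / deg v)) *: k y).
rewrite dirichletDZ // (dirichletC h k) !hE // kD hD => H.
have : 0 <= (2 * dot f D) - 8 / deg v * dot f f + (2 / deg v) ^+ 2 * (dot f f * deg v).
  apply: le_trans H _; rewrite sqrrN; apply: lerD.
    by rewrite le_eqVlt; apply/orP; left; apply/eqP; ring.
  by apply: ler_wpM2l => //; exact: sqr_ge0.
have -> : 2 * dot f D - 8 / deg v * dot f f + (2 / deg v) ^+ 2 * (dot f f * deg v) =
   2 / deg v * (deg v * dot f D - 2 * dot f f) by field; rewrite gt_eqF.
by rewrite pmulr_rge0 ?divr_gt0 // subr_ge0.
Qed.

End Collapse.

(** * Quadratic estimates from integral weights *)

Lemma nat_sqr_sum_le (R : realType) (T : choiceType) (A : set T)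
    (w a : T -> R) :
  finite_set A -> (forall e, w e \is a Num.nat) -> (forall e, 0 <= w e * a e) ->
  \sum_(e \in A) w e * a e ^+ 2 <= (\sum_(e \in A) w e * a e) ^+ 2.
Proof.
move=> finA wN wa0; rewrite !fsbig_finite //.
elim: (finmap.enum_fset _) => [|e r IH]; first by rewrite !big_nil expr0n.
rewrite !big_cons; set S := \sum_(_ <- _) w _ * a _ in IH *.
have S0 : 0 <= S by apply: sumr_ge0.
(* Integrality enters here: a natural weight is 0 or at least 1, so [w <= w^2]. *)
have we : w e * a e ^+ 2 <= (w e * a e) ^+ 2.
  have /natrP[[|m] ->] := wN e; first by rewrite !mul0r expr0n.
  rewrite exprMn ler_wpM2r ?sqr_ge0 // expr2 ler_peMr ?ler0n //.
  by rewrite ler1n.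
rewrite sqrrD; apply: lerD => //.
by rewrite (le_trans we) // lerDl mulrn_wge0 // mulr_ge0.
Qed.

(* As [\sum w a = 0], the parts of this sum over the two classes are opposite. *)
Lemma signed_nat_sqr_sum_le (R : realType) (T : choiceType) (A : set T)
    (c : T -> bool) (w a : T -> R) :
  finite_set A -> (forall e, w e \is a Num.nat) ->
  (forall e, A e -> if c e then 0 <= a e else a e <= 0) ->
  \sum_(e \in A) w e * a e = 0 ->
  \sum_(e \in A) w e * a e ^+ 2 <=
    2 * (\sum_(e \in A) (if c e then w e else 0) * a e) ^+ 2.
Proof.
move=> finA wN sgn sum0.
(* Weights are cut to one class and to [A], so that the sign conditions hold at every [e], as
   [nat_sqr_sum_le] requires. *)
pose wc (b : bool) e := if (e \in A) && (c e == b) then w e else 0.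
have wcN b e : wc b e \is a Num.nat by rewrite /wc; case: ifP.
have w0 e : 0 <= w e by rewrite natr_ge0.
have pos : forall e, 0 <= wc true e * a e.
  move=> e; rewrite /wc; case: ifP => [/andP[/set_mem/sgn + /eqP ce]|_].
    by rewrite ce => ae; rewrite mulr_ge0.
  by rewrite mul0r.
have neg : forall e, 0 <= wc false e * (- a e).
  move=> e; rewrite /wc; case: ifP => [/andP[/set_mem/sgn + /eqP ce]|_].
    by rewrite ce => ae; rewrite mulr_ge0 ?oppr_ge0.
  by rewrite mul0r.
have split_sum (F : T -> R) : \sum_(e \in A) w e * F e =
    \sum_(e \in A) wc true e * F e + \sum_(e \in A) wc false e * F e.
  rewrite -fsbig_split //; apply: eq_fsbigr => e eA; rewrite /wc eA /=.
  by case: (c e); rewrite /= ?mul0r ?addr0 ?add0r.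
have cE : \sum_(e \in A) (if c e then w e else 0) * a e =
    \sum_(e \in A) wc true e * a e.
  by apply: eq_fsbigr => e eA; rewrite /wc eA /=; case: (c e).
move: sum0; rewrite cE !split_sum => sum0.
have := nat_sqr_sum_le finA (wcN true) pos.
have := nat_sqr_sum_le finA (wcN false) neg.
under eq_fsbigr do rewrite sqrrN.
under [X in _ <= X ^+ 2]eq_fsbigr do rewrite mulrN -mulN1r.
rewrite -mulr_fsumr mulN1r sqrrN.
have -> : \sum_(e \in A) wc false e * a e = - \sum_(e \in A) wc true e * a e.
  by apply/eqP; rewrite -addr_eq0 addrC; apply/eqP.
rewrite sqrrN; lra.
Qed.

(** Pair the eigenvector equation with [u]: each rank-one term [x^T *m x] sends [u] to
    [(u . x) x]. *)
Lemma eigen_tension (R : realType) (N : nat) (X : wgraph R)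
    (Phi : vert X -> 'rV[R]_N) (v : vert X) (k : R) (u : 'rV[R]_N) :
  finite_set (star v) -> u *m tension Phi v = k *: u ->
  k * dot u u = \sum_(e \in star v) wt e * dot u (edge_vec Phi e) ^+ 2.
Proof.
move=> finS uk; rewrite -dotZr -uk /tension.
rewrite fsbig_finite // mulmx_sumr -fsbig_finite // dot_fsumr //.
apply: eq_fsbigr => e _; rewrite -scalemxAr dotZr mulmxA.
set x := edge_vec Phi e.
have -> : u *m x^T *m x = dot u x *: x.
  apply/rowP => i; rewrite !mxE big_ord1 !mxE; congr (_ * _).
  by apply: eq_bigr => j _; rewrite mxE.
by rewrite dotZr expr2.
Qed.

(** * The lower bound on the new edge *)

Unset Implicit Arguments.
Set Strict Implicit.
Local Close Scope quotient_scope.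
Local Close Scope classical_set_scope.

Theorem theorem6p1 (R : realType) (N : nat) (N_gt0 : (0 < N)%N)
  (K : R -> R) (K_gt0 : forall d : R, 0 < d -> 0 < K d)
  (X : Lgraph R N) (X_periodic : periodic X)
  (rho : {additive 'rV[int]_N -> 'rV[R]_N})
  (Phi : vert X -> 'rV[R]_N) (Phi_harmonic : harmonic rho Phi)
  (X_integral : forall e : edge X, wt e \is a Num.nat)
  (v : vert X) (Kv_gt0 : 0 < K (deg v))
  (Kv_max : max_eigenvalue (tension Phi v) (K (deg v)))
  (u : 'rV[R]_N) (u_eigen : eigenvector (tension Phi v) (K (deg v)) u)
  (s : split_data X) (s_along_u : split_along Phi v u s)
  (X'_periodic : periodic (split_graph v s))
  (Phi' : vert (split_graph v s) -> 'rV[R]_N) (Phi'_harmonic : harmonic rho Phi') :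
  enorm (edge_vec Phi' (split_e v s)) =
    enorm (Phi' (split_v1 v s) - Phi' (split_v0 v s)) /\
  Num.sqrt (2 * K (deg v)) / deg v <=
    enorm (Phi' (split_v1 v s) - Phi' (split_v0 v s)).
Proof.
split; first by [].
have [_ _ cover _ finE] := X_periodic; have [_ _ _ _ finE'] := X'_periodic.
(* If [deg v <= 0], the left side is at most 0, with the convention [0^-1 = 0]. *)
have [d0|dle0] := ltP 0 (deg v); last first.
  apply: le_trans (sqrtr_ge0 _).
  by rewrite mulr_ge0_le0 ?sqrtr_ge0 // invr_le0.
set D := Phi' _ - Phi' _; have [u0 uk] := u_eigen.
have finS := finite_star finE cover v.
set k := K (deg v) in Kv_gt0 uk *.
pose f := class_force v s Phi.
have fD : 2 * dot f f <= deg v * dot f D.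
  exact: (class_force_le finE finE' cover Phi_harmonic Phi'_harmonic d0).
have uf : dot u f = \sum_(e \in star v)
    (if cls s e then wt e else 0) * dot u (edge_vec Phi e).
  by rewrite dot_fsumr //; apply: eq_fsbigr => e _; rewrite dotZr.
have kf : k <= 2 * dot f f.
  have uu : 0 < dot u u by rewrite dot_gt0.
  rewrite -(ler_pM2r uu) (eigen_tension finS uk).
  apply: (le_trans (signed_nat_sqr_sum_le (c := cls s) finS X_integral _ _)).
  (* [split_along] does not constrain loops at [v]; their edge vector is 0, so either sign condition
     holds. *)
  - move=> e ev; have [tv|/eqP tv] := eqVneq (tgt e) v; last exact: s_along_u.
    by rewrite /edge_vec tv ev subrr dot0r lexx; case: ifP.
  - rewrite -[RHS](dot0r u) -(harmonic_balance v finE cover Phi_harmonic).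
    by rewrite dot_fsumr //; apply: eq_fsbigr => e _; rewrite dotZr.
  - by rewrite -uf -mulrA ler_wpM2l // mulrC dot_sqr_le.
rewrite ler_pdivrMr //.
(* Positivity of [k] gives [f != 0], so that [|f|] cancels in [2 |f|^2 <= deg v |f| |D|]. *)
have f0 : 0 < enorm f.
  by rewrite sqrtr_gt0; lra.
have Df : 2 * enorm f <= enorm D * deg v.
  rewrite -(ler_pM2l f0) mulrCA -expr2 enorm_sqr (le_trans fD) //.
  by rewrite [leRHS]mulrA [leRHS]mulrC ler_wpM2l ?dot_le_enorm // ltW.
apply: le_trans Df.
have -> : 2 * enorm f = Num.sqrt ((2 * enorm f) ^+ 2).
  by rewrite sqrtr_sqr ger0_norm // mulr_ge0 ?ltW.
by rewrite ler_wsqrtr // exprMn enorm_sqr; lra.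
Qed.
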